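(* Suppose $\mathcal Y=\{0,1\}$ and the potential outcomes are monotone in the decision, i.e. $Y(0)\le Y(1)\le\cdots\le Y(K-1)$. For $m=0,\dots,K$ let $s^m\in\{0,1\}^{\mathcal D}$ be given by $s^m_k=\mathbf 1\{k\ge m\}$, $k=0,\dots,K-1$, and let $\mathcal Y^{\mathcal D}_{\mathrm{mon}}=\{s^0,\dots,s^K\}\subseteq\{0,1\}^{\mathcal D}$, which is the maximal possible support of $(Y(0),\dots,Y(K-1))$ under monotonicity. Then every bounded counterfactual loss $\ell$ admits an additive representation on the monotone support: there exists an additive counterfactual loss $\ell^{\mathrm{add}}(d;\boldsymbol y,\boldsymbol x)=\varpi(\boldsymbol y,\boldsymbol x)+\sum_{k\in\mathcal D}\omega_k(d,y_k,\boldsymbol x)$, with $\omega_k:\mathcal D\times\mathcal Y\times\mathcal X\to\mathbb R$ and $\varpi:\mathcal Y^{\mathcal D}\times\mathcal X\to\mathbb R$ bounded measurable, such that $$\ell(d;\boldsymbol y,\boldsymbol x)=\ell^{\mathrm{add}}(d;\boldsymbol y,\boldsymbol x)\quad\text{for all } d\in\mathcal D,\ \boldsymbol y\in\mathcal Y^{\mathcal D}_{\mathrm{mon}},\ \boldsymbol x\in\mathcal X.$$ A choice of weights for such an $\ell^{\mathrm{add}}$ is given by $$\omega_k(d,y,\boldsymbol x)=\frac1K\,\ell(d;s^K,\boldsymbol x)+y\left[\ell(d;s^k,\boldsymbol x)-\ell(d;s^{k+1},\boldsymbol x)\right].$$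
   Context: $\mathcal X$ is an arbitrary measurable space (covariates), $K\ge 2$ an integer, $\mathcal D=\{0,\dots,K-1\}$ (decisions), $\mathcal Y=\{0,1\}$ (outcomes). $Y(k)\in\mathcal Y$ denotes the potential outcome under decision $k\in\mathcal D$. A counterfactual loss is a measurable function $\ell:\mathcal D\times\mathcal Y^{\mathcal D}\times\mathcal X\to\mathbb R$, written $\ell(d;\boldsymbol y,\boldsymbol x)$ with $\boldsymbol y=(y_0,\dots,y_{K-1})$; it is bounded if $\sup|\ell|<\infty$. *)

(* Defs.v *)
From HB Require Import structures.
From mathcomp Require Import all_boot all_order all_algebra.
From mathcomp Require Import all_classical all_reals all_analysis.
Import numFieldNormedType.Exports.

Set Implicit Arguments.
Unset Strict Implicit.
Unset Printing Implicit Defensive.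

Local Open Scope classical_set_scope.
Local Open Scope ring_scope.

HB.instance Definition _ (n : nat) := isPointed.Build 'I_n.+1 ord0.
HB.instance Definition _ (n : nat) := @isMeasurable.Build
  default_measure_display 'I_n.+1 discrete_measurable discrete_measurable0
  discrete_measurableC discrete_measurableU.

(* {0, ..., K-1} for K > 0, written so that it is visibly inhabited: the
   library's measurable types are pointed. It has the discrete sigma-algebra. *)
Notation decision K := 'I_K.-1.+1.

(* Vectors (y_0, ..., y_{K-1}) in {0,1}^K, with y_k = tnth y k; the library
   equips them with the product sigma-algebra, here that of all subsets. *)
Notation outcomes K := (K.-1.+1.-tuple bool).

Definition step_vector (K m : nat) : outcomes K :=
  [tuple (m <= k)%N | k < K.-1.+1].

Definition mono_support (K : nat) : set (outcomes K) :=
  [set y | exists2 m : nat, (m <= K)%N & y = step_vector K m].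
Arguments mono_support : clear implicits.

Section potential_outcomes.
Context {R : realType} {dO : measure_display} {Omega : measurableType dO}.
Variables (P : probability Omega R) (K : nat).
Variable Y : decision K -> {mfun Omega >-> bool}.

(* Y(0) <= ... <= Y(K-1) almost surely; bool is coerced to {0,1} in nat. *)
Definition monotone_outcomes : Prop :=
  {ae P, forall w : Omega,
     forall j k : decision K, (j <= k)%N -> (Y j w <= Y k w)%N}.

(* Support of a random vector with finitely many values: its atoms. *)
Definition outcome_support : set (outcomes K) :=
  [set y | (0 < P [set w | [tuple Y k w | k < K.-1.+1] = y])%E].

End potential_outcomes.

Section additive_losses.
Context {R : realType} {d : measure_display} {X : measurableType d} {K : nat}.

Definition bounded_measurable {d'} {T : measurableType d'} (f : T -> R) :=
  measurable_fun [set: T] f /\ bounded_fun f.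

Definition additive_loss (omega : decision K -> decision K * bool * X -> R)
    (varpi : outcomes K * X -> R) (z : decision K * outcomes K * X) : R :=
  let: (a, y, x) := z in
  varpi (y, x) + \sum_(k < K.-1.+1) omega k (a, tnth y k, x).

Definition additive_representation_on (S : set (outcomes K))
    (l : decision K * outcomes K * X -> R)
    (omega : decision K -> decision K * bool * X -> R)
    (varpi : outcomes K * X -> R) : Prop :=
  [/\ forall k, bounded_measurable (omega k),
      bounded_measurable varpi
    & forall a y x, S y -> l (a, y, x) = additive_loss omega varpi (a, y, x)].

Definition mono_weights (l : decision K * outcomes K * X -> R)
    (k : decision K) (z : decision K * bool * X) : R :=
  let: (a, y, x) := z in
  K%:R^-1 * l (a, step_vector K K, x) +
  y%:R * (l (a, step_vector K k, x) - l (a, step_vector K k.+1, x)).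

End additive_losses.

(* Main.v *)
Require Import Defs.
From HB Require Import structures.
From mathcomp Require Import all_boot all_order all_algebra finmap.
From mathcomp Require Import all_classical all_reals all_analysis measurable_realfun.
Import numFieldNormedType.Exports.
Local Open Scope classical_set_scope.
Local Open Scope ring_scope.
Import Order.TTheory GRing.Theory Num.Theory.

(** A nondecreasing 0/1 vector is a step: it is 0 before its first 1 and 1 from
there on. An atom of the outcome vector has positive mass, hence meets the
almost sure event on which the outcomes are nondecreasing, so it is a step
vector ([outcome_support_sub_mono]). No smaller set would do: when a threshold
[w] is drawn uniformly from {0, ..., K}, the outcomes Y(k) = 1{k >= w} are
monotone and take each of the K + 1 step vectors with positive probability
([mono_support_attained]).

On this chain of vectors an additive loss is flexible enough to telescope.
Write f m for the loss at s^m, with the decision and the covariates fixed.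
Component k of s^m is 1 exactly when k >= m, so the increments f k - f (k + 1)
that the weights switch on at s^m are those with m <= k < K, whose sum is
f m - f K; the K constant terms f K / K add back f K, and the total is f m
([mono_weights_sum]). The intercept varpi can therefore be zero, and the
weights inherit boundedness and measurability from the loss, of which they are
finite combinations. *)

Lemma tnth_step_vector (K m : nat) (k : decision K) :
  tnth (step_vector K m) k = (m <= k)%N.
Proof. by rewrite tnth_mktuple. Qed.

(** The threshold is the index of the first 1; for the zero vector [find]
returns the length K, which is the threshold of s^K. *)
Lemma mono_support_monotone (K : nat) (y : outcomes K) : (0 < K)%N ->
  (forall j k : decision K, (j <= k)%N -> (tnth y j <= tnth y k)%N) ->
  mono_support K y.
Proof.
move=> K_gt0 y_mono; exists (find id y).
  by rewrite -[leqRHS](prednK K_gt0) -[leqRHS](size_tuple y) find_size.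
apply: eq_from_tnth => k; rewrite tnth_step_vector (tnth_nth false).
have [find_le_k|k_lt_find] := leqP (find id y) k; last first.
  by rewrite -[LHS]/(id _) before_find.
have has_y : has id y.
  by rewrite has_find (leq_ltn_trans find_le_k)// size_tuple.
have find_lt : (find id y < K.-1.+1)%N.
  by rewrite -[ltnRHS](size_tuple y) -has_find.
have := y_mono (Ordinal find_lt) k find_le_k.
by rewrite !(tnth_nth false)/= (nth_find false has_y) lt0b.
Qed.

Lemma outcome_support_sub_mono (R : realType) (dO : measure_display)
    (Omega : measurableType dO) (P : probability Omega R) (K : nat)
    (Y : decision K -> {mfun Omega >-> bool}) :
  (0 < K)%N -> monotone_outcomes P Y -> outcome_support P Y `<=` mono_support K.
Proof.
move=> K_gt0 [N [mN PN0 nonmonoN]] y; rewrite /outcome_support/= => Py_gt0.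
apply: contrapT => y_notin.
suff Py0 :
    P [set w | [tuple Y k w | k < K.-1.+1] = y] = 0%E.
  by rewrite Py0 ltxx in Py_gt0.
(* Monotonicity of measure is stated for measurable sets; this one is a finite
   intersection of level sets of the coordinates. *)
have mA : measurable [set w | [tuple Y k w | k < K.-1.+1] = y].
  rewrite [X in measurable X](_ : _ =
      \bigcap_(k in [set: decision K]) (Y k @^-1` [set tnth y k])).
    apply: fin_bigcap_measurable => // k _.
    by rewrite -[X in measurable X]setTI; exact: measurable_funPT.
  apply/seteqP; split => w /= Ywy.
    by move=> k _ /=; rewrite -Ywy tnth_mktuple.
  by apply: eq_from_tnth => k; rewrite tnth_mktuple Ywy.
apply: (subset_measure0 mA mN) PN0 => w /= Ywy.
apply: nonmonoN => /= Yw_mono; apply: y_notin.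
apply: mono_support_monotone => // j k jk.
by rewrite -Ywy !tnth_mktuple; exact: Yw_mono.
Qed.

(** Since the counting measure of the whole space is neither 0 nor infinite,
the normalization never falls back on its default [P]. *)
Lemma normalized_counting_gt0 (R : realType) (n : nat)
    (P : probability 'I_n.+1 R) (A : set 'I_n.+1) :
  A !=set0 -> (0 < mnormalize (@counting 'I_n.+1 R) P A)%E.
Proof.
have counting_fin (B : set 'I_n.+1) :
    counting B = (#|` fset_set B|)%:R%:E :> \bar R.
  by rewrite /counting asboolT//; exact: finite_finset.
have counting_gt0 (B : set 'I_n.+1) : B !=set0 -> (0 < @counting _ R B)%E.
  move=> [i Bi]; rewrite counting_fin lte_fin ltr0n cardfs_gt0.
  by apply/fset0Pn; exists i; rewrite in_fset_set ?inE//; exact: finite_finset.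
move=> A0; have T_gt0 := counting_gt0 setT (ex_intro _ ord0 I).
rewrite /mnormalize gt_eqF//= counting_fin/=.
by rewrite mule_gt0 ?counting_gt0// lte_fin invr_gt0 -lte_fin -counting_fin.
Qed.

(** The sample space is the set of thresholds itself, and threshold [m] yields
the step vector s^m; the uniform law charges all of them. *)
Lemma mono_support_attained (R : realType) (K : nat) : (0 < K)%N ->
  exists (dO : measure_display) (Omega : measurableType dO)
         (P : probability Omega R) (Y : decision K -> {mfun Omega >-> bool}),
    monotone_outcomes P Y /\ outcome_support P Y = mono_support K.
Proof.
move=> K_gt0; exists default_measure_display, 'I_K.+1.
exists (mnormalize (@counting _ R) (\d_(ord0 : 'I_K.+1))).
have mY (k : decision K) :
    measurable_fun [set: 'I_K.+1] (fun w : 'I_K.+1 => (w <= k)%N) by [].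
pose Y (k : decision K) : {mfun 'I_K.+1 >-> bool} :=
  HB.pack (fun w : 'I_K.+1 => (w <= k)%N)
    (isMeasurableFun.Build _ _ _ _ _ (mY k)).
exists Y.
have Y_mono w (j k : decision K) : (j <= k)%N -> (Y j w <= Y k w)%N.
  move=> jk; rewrite /Y/=; case: (leqP w j) => //= wj.
  by rewrite (leq_trans wj jk).
have mono : monotone_outcomes (mnormalize (@counting _ R) (\d_(ord0 : 'I_K.+1))) Y.
  by apply: aeW => w; exact: Y_mono.
split=> //; apply/seteqP; split; first exact: outcome_support_sub_mono.
move=> _ [m mK ->]; apply: normalized_counting_gt0.
by exists (Ordinal (mK : (m < K.+1)%N)).
Qed.

(** The indicator truncates the telescoping sum on the left at [m]. *)
Lemma telescope_step (V : pzRingType) (f : nat -> V) (m n : nat) : (m <= n)%N ->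
  \sum_(k < n) (m <= k)%N%:R * (f k - f k.+1) = f m - f n.
Proof.
elim: n => [|n IHn]; first by rewrite leqn0 => /eqP ->; rewrite big_ord0 subrr.
rewrite leq_eqVlt ltnS => /predU1P[->|mn].
  rewrite big1 ?subrr// => k _.
  by rewrite leqNgt ltn_ord mul0r.
by rewrite big_ord_recr/= IHn// mn mul1r addrA subrK.
Qed.

Lemma bounded_fun_le (T : Type) (R : realType) (f : T -> R) (M : R) :
  (forall z, `|f z| <= M) -> bounded_fun f.
Proof.
move=> fM; exists M; split=> [|r Mr z _]; first exact: num_real.
exact: le_trans (fM z) (ltW Mr).
Qed.

Section losses.
Context {R : realType} {d : measure_display} {X : measurableType d} {K : nat}.
Implicit Type l : decision K * outcomes K * X -> R.

(** The increments switched on at s^m telescope to the difference between the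
losses at s^m and s^K, and the constant parts sum to the loss at s^K. *)
Lemma mono_weights_sum l (m : nat) (a : decision K) (x : X) :
  (0 < K)%N -> (m <= K)%N ->
  \sum_(k < K.-1.+1) mono_weights l k (a, tnth (step_vector K m) k, x) =
  l (a, step_vector K m, x).
Proof.
(* Naming [f] hides the occurrences of [K.-1.+1] in the types of [a] and of the
   step vectors, which [prednK] could not rewrite. *)
move=> K_gt0 mK; pose f i := l (a, step_vector K i, x).
have weightE (k : decision K) :
    mono_weights l k (a, tnth (step_vector K m) k, x) =
    K%:R^-1 * f K + (m <= k)%N%:R * (f k - f k.+1).
  by rewrite /mono_weights tnth_step_vector.
rewrite -[RHS]/(f m) (eq_bigr _ (fun k _ => weightE k)) big_split/=.
rewrite sumr_const card_ord telescope_step prednK//.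
by rewrite -mulrnAl -mulr_natr mulVf ?pnatr_eq0 ?gtn_eqF// mul1r addrC subrK.
Qed.

(** Freezing the outcome argument of the loss at a step vector preserves
measurability, and the factor [y%:R] is measurable because its argument is
discrete. *)
Lemma mono_weights_bounded_measurable l (k : decision K) :
  bounded_measurable l -> bounded_measurable (mono_weights l k).
Proof.
move=> [ml [M0 [_ bl]]]; split.
  pose slice (s : outcomes K) (z : decision K * bool * X) := l (z.1.1, s, z.2).
  have mslice s : measurable_fun [set: decision K * bool * X] (slice s).
    apply: measurableT_comp => //; apply: measurable_fun_pair => //.
    by apply: measurable_fun_pair => //; exact: measurableT_comp.
  rewrite (_ : mono_weights l k = (fun z : decision K * bool * X =>
      K%:R^-1 * slice (step_vector K K) z +
      z.1.2%:R * (slice (step_vector K k) z - slice (step_vector K k.+1) z))).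
    apply: measurable_funD; first exact: measurable_funM.
    apply: measurable_funM; last exact: measurable_funB.
    have mnat : measurable_fun [set: bool] (fun b : bool => b%:R : R) by [].
    by apply: (measurableT_comp mnat); exact: measurableT_comp.
  by apply/funext => -[[a y] x].
(* [bounded_fun] provides the bounds strictly above [M0]; [M0 + 1] is one. *)
have {}bl z : `|l z| <= M0 + 1 by apply: bl I; rewrite /= ltrDl.
apply: (bounded_fun_le _ _ _ (`|K%:R^-1| * (M0 + 1) + ((M0 + 1) + (M0 + 1)))).
move=> [[a y] x] /=.
apply: (le_trans (ler_normD _ _)); apply: lerD.
  by rewrite normrM ler_wpM2l.
rewrite normrM; case: y => /=; rewrite ?normr1 ?mul1r ?normr0 ?mul0r.
  by apply: (le_trans (ler_normB _ _)); apply: lerD.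
by apply: addr_ge0; apply: le_trans (normr_ge0 _) (bl (a, step_vector K K, x)).
Qed.

Lemma mono_weights_representation l : (0 < K)%N -> bounded_measurable l ->
  additive_representation_on (mono_support K) l (mono_weights l) (cst 0).
Proof.
move=> K_gt0 hl; split.
- by move=> k; exact: mono_weights_bounded_measurable.
- split; first exact: measurable_cst.
  by apply: (bounded_fun_le _ _ _ 0) => z; rewrite normr0.
- by move=> a _ x [m mK ->]; rewrite /additive_loss add0r mono_weights_sum.
Qed.

End losses.

Theorem proposition3 (R : realType) (d : measure_display) (X : measurableType d)
    (K : nat) (hK : (2 <= K)%N)
    (dO : measure_display) (Omega : measurableType dO) (P : probability Omega R)
    (Y : decision K -> {mfun Omega >-> bool}) (hY : monotone_outcomes P Y) :
  [/\ outcome_support P Y `<=` mono_support K,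
      exists (dO' : measure_display) (Omega' : measurableType dO')
             (P' : probability Omega' R)
             (Y' : decision K -> {mfun Omega' >-> bool}),
        monotone_outcomes P' Y' /\ outcome_support P' Y' = mono_support K
    & forall l : decision K * outcomes K * X -> R,
        bounded_measurable l ->
        (exists (omega : decision K -> decision K * bool * X -> R)
                (varpi : outcomes K * X -> R),
           additive_representation_on (mono_support K) l omega varpi) /\
        (exists varpi : outcomes K * X -> R,
           additive_representation_on (mono_support K) l (mono_weights l) varpi)].
Proof.
have K_gt0 : (0 < K)%N := ltnW hK.
split.
- exact: outcome_support_sub_mono.
- exact: mono_support_attained.
- move=> l hl; have rep := mono_weights_representation _ K_gt0 hl.
  by split; [exists (mono_weights l)|]; exists (cst 0).
Qed.
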